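(* Every output $(Q,c)$ of Algorithm 1 (described in the context) belongs to $\mathcal{E}_R$. Conversely, any $(Q,c)\in\mathcal{E}_R$ can be generated by Algorithm 1 with appropriate choices of $\mathbb{L}\subseteq\{1,\dots,n\}$ and $(\hat u,\hat v,\hat W,\hat Y,\hat Z)\in\mathbb{R}^n\times\mathbb{R}^n\times\mathcal{S}^n\times\mathbb{R}^{n\times n}\times\mathcal{S}^n$.
   Context: Let $n \ge 1$, let $\mathcal{S}^n$ be the space of real symmetric $n\times n$ matrices, $e \in \mathbb{R}^n$ the all-ones vector, $\langle A,B\rangle = \mathrm{trace}(A^TB)$; inequalities on vectors and matrices are componentwise. For index sets $\mathbb{J},\mathbb{K}$, $x_{\mathbb{K}}$ is the subvector of $x$ indexed by $\mathbb{K}$ and $B_{\mathbb{J}\mathbb{K}}$ the submatrix of $B$ with rows in $\mathbb{J}$ and columns in $\mathbb{K}$. For $(Q,c) \in \mathcal{S}^n\times\mathbb{R}^n$ let $q(x) = \frac12 x^TQx + c^Tx$, $F = \{x \in \mathbb{R}^n : 0 \le x \le e\}$, and $\ell^* = \min_{x\in F} q(x)$ (the problem (BoxQP)). Let $$\mathcal{F}_R = \{(x,X)\in\mathbb{R}^n\times\mathcal{S}^n : 0\le x\le e,\ \max\{x_i+x_j-1,0\}\le X_{ij}\le \min\{x_i,x_j\},\ 1\le i\le j\le n\},$$ $\ell^*_R = \min\{\frac12\langle Q,X\rangle + c^Tx : (x,X)\in\mathcal{F}_R\}$ (the RLT relaxation), and $\mathcal{E}_R = \{(Q,c)\in\mathcal{S}^n\times\mathbb{R}^n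 : \ell^*=\ell^*_R\}$. Algorithm 1. Input: $n$ and $\mathbb{L}\subseteq\{1,\dots,n\}$. Set $\mathbb{U}=\{1,\dots,n\}\setminus\mathbb{L}$. Choose arbitrary $\hat u\in\mathbb{R}^n$ with $\hat u\ge0$, $\hat u_{\mathbb{L}}=0$; $\hat v\in\mathbb{R}^n$ with $\hat v\ge0$, $\hat v_{\mathbb{U}}=0$; $\hat W\in\mathcal{S}^n$ with $\hat W\ge0$, $\hat W_{\mathbb{L}\mathbb{L}}=0$; $\hat Y\in\mathbb{R}^{n\times n}$ with $\hat Y\ge0$, $\hat Y_{\mathbb{L}\mathbb{U}}=0$; $\hat Z\in\mathcal{S}^n$ with $\hat Z\ge0$, $\hat Z_{\mathbb{U}\mathbb{U}}=0$. Output $(Q,c)$ with $Q=\hat W-\hat Y-\hat Y^T+\hat Z$ and $c=-\hat u+\hat v-\hat We+\hat Y^Te$. *)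

(* Defs.v *)
From mathcomp Require Import all_boot all_order all_algebra.
From mathcomp Require Import classical_sets reals.

Set Implicit Arguments.
Unset Strict Implicit.
Unset Printing Implicit Defensive.

Import Order.TTheory GRing.Theory Num.Theory.

Local Open Scope classical_set_scope.
Local Open Scope ring_scope.

Section BoxQP.
Variables (R : realType) (n : nat).

Definition Sym : set 'M[R]_n := [set A | A^T = A].

Definition ones : 'cV[R]_n := const_mx 1.

Definition le_mx (m p : nat) (A B : 'M[R]_(m, p)) : Prop :=
  forall i j, A i j <= B i j.

Definition frob (A B : 'M[R]_n) : R := \tr (A^T *m B).

(* [zero_on J x] is x_J = 0 and [zero_block J K B] is B_JK = 0. *)
Definition zero_on (J : {set 'I_n}) (x : 'cV[R]_n) : Prop :=
  forall i, i \in J -> x i 0 = 0.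

Definition zero_block (J K : {set 'I_n}) (B : 'M[R]_n) : Prop :=
  forall i j, i \in J -> j \in K -> B i j = 0.

Definition is_min (A : set R) (l : R) : Prop := A l /\ lbound A l.

Definition box : set 'cV[R]_n := [set x | le_mx 0 x /\ le_mx x ones].

Definition quad (Q : 'M[R]_n) (c x : 'cV[R]_n) : R :=
  2^-1 * (x^T *m Q *m x) 0 0 + (c^T *m x) 0 0.

Definition boxqp_value (Q : 'M[R]_n) (c : 'cV[R]_n) (l : R) : Prop :=
  is_min [set quad Q c x | x in box] l.

Definition rlt_feasible : set ('cV[R]_n * 'M[R]_n) :=
  [set xX | [/\ Sym xX.2, le_mx 0 xX.1, le_mx xX.1 ones &
    forall i j : 'I_n, (i <= j)%N ->
      Num.max (xX.1 i 0 + xX.1 j 0 - 1) 0 <= xX.2 i j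
        <= Num.min (xX.1 i 0) (xX.1 j 0)]].

Definition rlt_obj (Q : 'M[R]_n) (c : 'cV[R]_n) (xX : 'cV[R]_n * 'M[R]_n) : R :=
  2^-1 * frob Q xX.2 + (c^T *m xX.1) 0 0.

Definition rlt_value (Q : 'M[R]_n) (c : 'cV[R]_n) (l : R) : Prop :=
  is_min [set rlt_obj Q c xX | xX in rlt_feasible] l.

(* Both feasible sets are nonempty and compact, so the two minima exist and
   equality of the optimal values means having a common minimum value. *)
Definition exact_rlt : set ('M[R]_n * 'cV[R]_n) :=
  [set Qc | Sym Qc.1 /\
    exists l, boxqp_value Qc.1 Qc.2 l /\ rlt_value Qc.1 Qc.2 l].

Definition alg1_choice (L : {set 'I_n}) (u v : 'cV[R]_n) (W Y Z : 'M[R]_n) : Prop :=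
  let U := ~: L in
  [/\ le_mx 0 u /\ zero_on L u,
      le_mx 0 v /\ zero_on U v,
      [/\ Sym W, le_mx 0 W & zero_block L L W],
      le_mx 0 Y /\ zero_block L U Y &
      [/\ Sym Z, le_mx 0 Z & zero_block U U Z]].

Definition alg1_output (u v : 'cV[R]_n) (W Y Z : 'M[R]_n) : 'M[R]_n * 'cV[R]_n :=
  (W - Y - Y^T + Z, - u + v - W *m ones + Y^T *m ones).

End BoxQP.

(* Main.v *)
Require Import Defs.
From mathcomp Require Import all_boot all_order all_algebra.
From mathcomp Require Import classical_sets reals.
From mathcomp Require Import boolp ring lra.

Set Implicit Arguments.
Unset Strict Implicit.
Unset Printing Implicit Defensive.

Import Order.TTheory GRing.Theory Num.Theory.

Local Open Scope classical_set_scope.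
Local Open Scope ring_scope.

(** Weigh each constraint of the relaxation by a multiplier: [u] for
    [x <= e], [v] for [0 <= x], [W] for [x_i + x_j - 1 <= X_ij], [Y] for
    [X_ij <= x_j] and [Z] for [0 <= X_ij].  The formulas of the algorithm say
    exactly that the linear objective is a constant plus the weighted sum of
    the slacks, [lagrangian]; the zero patterns attached to [L] say exactly
    that the slacks which carry weight vanish at the lifting [(x, x x^T)] of
    the 0/1 vector [x] with zero set [L].  Since [q] is the relaxed objective
    restricted to such liftings, the proposition is LP duality with
    complementary slackness.

    Output implies exactness ([alg1_exact]): by [alg1_obj] the constant is a
    lower bound on the relaxation, and the lifting of the vertex [x] attains
    it.

    Exactness implies output ([exact_alg1]): let [x] minimise [q] over the box.
    By exactness [(x, x x^T)] is optimal for the relaxation, with value [l].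
    Homogenising by a scale [t], feasibility of all constraints implies
    [objective - l t >= 0] ([rlt_homogenization]), so [farkas] writes this
    form as a nonnegative combination of the constraint slacks.  Comparing
    coefficients gives the formulas of the algorithm ([lagrangian_alg1]), and
    evaluating at [(1, x, x x^T)], where the form is zero, gives
    complementarity.  The minimiser need not be a vertex: a slack of a
    constraint at [(x, x x^T)] is a product of factors [x_i] and [1 - x_j], so
    taking [L] to be the set of indices with [x_i <> 1] already yields every
    required zero block. *)

(** * Farkas' lemma *)

Section Farkas.
Variables (R : realFieldType) (V : lmodType R).

Lemma scalar_form0 (f : V -> R) : scalar f -> f 0 = 0.
Proof.
by move=> lf; rewrite -[X in f X](scaler0 _ (-1)) -[X in f X]addr0 lf; ring.
Qed.

Lemma scalar_formN (f : V -> R) z : scalar f -> f (- z) = - f z.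
Proof.
by move=> lf; rewrite -scaleN1r -[X in f X]addr0 lf (scalar_form0 lf); ring.
Qed.

(** Induction on the number of forms, after Bartl.  If the implication already
    holds without the form [a m], give [m] the weight zero.  Otherwise some
    [z0] is nonnegative on the other forms and negative on [b]; it must be
    negative on [a m], hence can be scaled to [a m z0 = -1].  Then
    [z |-> a m z *: z0 + z] projects onto the kernel of [a m], and the
    induction hypothesis applies to the forms composed with this projection. *)
Lemma farkas (I : eqType) (r : seq I) (a : I -> V -> R) (b : V -> R) :
    uniq r -> (forall i, scalar (a i)) -> scalar b ->
    (forall z, (forall i, i \in r -> 0 <= a i z) -> 0 <= b z) ->
  exists y : I -> R,
    (forall i, 0 <= y i) /\ (forall z, b z = \sum_(i <- r) y i * a i z).
Proof.
elim: r a b => [|m r IHr] a b /=.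
  move=> _ _ lb b_ge0; exists (fun=> 0); split=> // z.
  have bz : 0 <= b z by exact: b_ge0.
  have bNz : 0 <= b (- z) by exact: b_ge0.
  rewrite big_nil; move: bNz; rewrite (scalar_formN _ lb); lra.
move=> /andP[mr ur] la lb b_ge0.
have notm i : i \in r -> (i == m) = false.
  by move=> ir; apply/eqP => im; move: ir; rewrite im (negbTE mr).
have [imp|] := pselect
  (forall z, (forall i, i \in r -> 0 <= a i z) -> 0 <= b z).
  have [y [y_ge0 by_]] := IHr a b ur la lb imp.
  exists (fun i => if i == m then 0 else y i); split=> [i|z].
    by case: ifP.
  rewrite big_cons eqxx mul0r add0r by_.
  by apply: eq_big_seq => i /notm ->.
move=> /existsNP[z1 /not_implyP[az1 /negP]]; rewrite -ltNge => bz1.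
have amz1 : a m z1 < 0.
  rewrite ltNge; apply/negP => amz1; move: bz1; rewrite ltNge => /negP; apply.
  by apply: b_ge0 => i; rewrite inE => /predU1P[->|/az1].
pose z0 := (- (a m z1)^-1) *: z1 + 0.
have z0E f : scalar f -> f z0 = - (a m z1)^-1 * f z1.
  by move=> lf; rewrite lf (scalar_form0 lf) addr0.
have s_gt0 : 0 < - (a m z1)^-1 by rewrite oppr_gt0 invr_lt0.
have amz0 : a m z0 = -1 by rewrite z0E // mulNr mulVf ?lt_eqF.
have az0 i : i \in r -> 0 <= a i z0.
  by move=> ir; rewrite z0E // mulr_ge0 ?az1 ?ltW.
have bz0 : b z0 < 0 by rewrite z0E // pmulr_rlt0.
(* As long as [z0] is transparent, linearity would rewrite inside it. *)
clear z0E; clearbody z0.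
pose p (f : V -> R) z := f z + a m z * f z0.
have lp f : scalar f -> scalar (p f).
  by move=> lf k u v; rewrite /p lf la; ring.
have pE f z : scalar f -> p f z = f (a m z *: z0 + z).
  by move=> lf; rewrite /p lf addrC.
have [z pz|y [y_ge0 py]] := IHr (fun i => p (a i)) (p b) ur
    (fun i => lp _ (la i)) (lp _ lb).
  rewrite pE //; apply: b_ge0 => i; rewrite inE => /predU1P[->|ir].
    by rewrite la amz0; lra.
  by rewrite -pE //; exact: pz.
(* [p b = \sum y i * p (a i)] leaves this coefficient on [a m]. *)
exists (fun i => if i == m then \sum_(j <- r) y j * a j z0 - b z0 else y i).
split=> [i|z].
  case: ifP => // _; rewrite subr_ge0 (le_trans (ltW bz0)) //.
  by rewrite big_seq sumr_ge0 // => j jr; rewrite mulr_ge0 ?az0.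
rewrite big_cons eqxx.
have -> : b z = p b z - a m z * b z0 by rewrite /p; ring.
rewrite py.
under [X in _ = _ + X]eq_big_seq => i ir do rewrite (notm _ ir).
rewrite /p /=; under eq_bigr => i _ do rewrite mulrDr mulrCA.
rewrite big_split /= -mulr_sumr; ring.
Qed.
End Farkas.

(** * The relaxation and its rank-one points *)

Section Exactness.
Variables (R : realType) (n : nat).
Implicit Types (Q W Y Z X D : 'M[R]_n) (c u v x : 'cV[R]_n) (L : {set 'I_n}).

Lemma rlt_objE Q c x X : rlt_obj Q c (x, X) =
  2^-1 * (\sum_i \sum_j Q i j * X i j) + \sum_i c i 0 * x i 0.
Proof.
rewrite /rlt_obj /frob /mxtrace /= mxE exchange_big /=; congr (_ * _ + _).
  by apply: eq_bigr => i _; rewrite mxE; apply: eq_bigr => j _; rewrite mxE.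
by apply: eq_bigr => i _; rewrite mxE.
Qed.

Lemma rank1E x i j : (x *m x^T) i j = x i 0 * x j 0.
Proof. by rewrite mxE big_ord1 mxE. Qed.

Lemma quad_rlt_obj Q c x : quad Q c x = rlt_obj Q c (x, x *m x^T).
Proof.
rewrite rlt_objE /quad !mxE; congr (_ * _ + _); last first.
  by apply: eq_bigr => i _; rewrite mxE.
rewrite exchange_big /=; apply: eq_bigr => j _; rewrite !mxE mulr_suml.
by apply: eq_bigr => i _; rewrite rank1E !mxE; ring.
Qed.

Lemma boxP x : box x <-> forall i, 0 <= x i 0 <= 1.
Proof.
split=> [[x0 x1] i|xb].
  by move: (x0 i 0) (x1 i 0); rewrite !mxE => -> ->.
by split=> i j; rewrite !mxE (ord1 j); case/andP: (xb i).
Qed.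

(** By symmetry of [X] the constraints may be imposed on all ordered pairs, and
    then [X i j <= x j 0] alone accounts for both upper bounds.  The lower
    slack is written with the terms in the order used by [lagrangian]. *)
Lemma rlt_feasibleP x X : rlt_feasible (x, X) <->
  [/\ X^T = X, box x & forall i j,
      [/\ 0 <= X i j, 0 <= X i j - x i 0 - x j 0 + 1 & 0 <= x j 0 - X i j]].
Proof.
split=> [[/= sX x0 x1 bX]|[sX [x0 x1] bX]].
  have sXE i j : X j i = X i j by rewrite -[in RHS]sX mxE.
  split=> // i j; have [ij|/ltnW ij] := leqP i j; have := bX _ _ ij.
    rewrite le_min ge_max => /andP[/andP[? ?] /andP[? ?]]; split=> //; lra.
  rewrite le_min ge_max sXE => /andP[/andP[? ?] /andP[? ?]]; split=> //; lra.
split=> //= i j _; rewrite le_min ge_max.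
have [? ? ?] := bX i j; have [_ _] := bX j i; rewrite -[in X j i]sX mxE => ?.
by apply/andP; split; apply/andP; split; lra.
Qed.

(** The slacks at [x x^T] are the products [x_i x_j], [(1 - x_i)(1 - x_j)] and
    [(1 - x_i) x_j]. *)
Lemma rank1_feasible x : box x -> rlt_feasible (x, x *m x^T).
Proof.
move=> xb; apply/rlt_feasibleP; split=> // [|i j].
  by rewrite trmx_mul trmxK.
have /boxP xb' := xb; rewrite rank1E.
by have /andP[? ?] := xb' i; have /andP[? ?] := xb' j; split; nra.
Qed.

(** * Outputs of the algorithm are exact *)

(** The scale [t] stands for the constant 1 of the affine constraints; it is a
    variable because coefficients are later compared in homogeneous form. *)
Definition lagrangian u v W Y Z (t : R) x X : R :=
  \sum_i u i 0 * (t - x i 0) + \sum_i v i 0 * x i 0 +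
  \sum_i \sum_j W i j * (X i j - x i 0 - x j 0 + t) +
  \sum_i \sum_j Y i j * (x j 0 - X i j) +
  \sum_i \sum_j Z i j * X i j.

(** The quadratic part of the objective carries a factor one half; it stays on
    [W] and [Z], while [Y] occurs twice, as [Y] and [Y^T], and loses it. *)
Lemma alg1_obj u v W Y Z x X : Sym W -> Sym X ->
  rlt_obj (alg1_output u v W Y Z).1 (alg1_output u v W Y Z).2 (x, X) =
    - (\sum_i u i 0 + 2^-1 * \sum_i \sum_j W i j) +
    lagrangian u v (2^-1 *: W) Y (2^-1 *: Z) 1 x X.
Proof.
move=> sW sX; rewrite rlt_objE /lagrangian.
have sXE i j : X j i = X i j by rewrite -[in RHS]sX mxE.
have sWE i j : W j i = W i j by rewrite -[in RHS]sW mxE.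
have -> : \sum_i \sum_j (alg1_output u v W Y Z).1 i j * X i j =
    \sum_i \sum_j W i j * X i j - (\sum_i \sum_j Y i j * X i j) *+ 2
    + \sum_i \sum_j Z i j * X i j.
  rewrite mulr2n [T in _ - (T + _)]exchange_big /= opprD addrA.
  rewrite -!sumrB -big_split; apply: eq_bigr => i _; rewrite -!sumrB -big_split.
  by apply: eq_bigr => j _; rewrite !mxE /= sXE; ring.
have -> : \sum_i (alg1_output u v W Y Z).2 i 0 * x i 0 =
    \sum_i v i 0 * x i 0 - \sum_i u i 0 * x i 0
    - \sum_i \sum_j W i j * x i 0 + \sum_i \sum_j Y i j * x j 0.
  rewrite [T in _ + T]exchange_big /= -!sumrB -big_split.
  apply: eq_bigr => i _; rewrite !mxE /= -!mulr_suml.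
  have -> : \sum_j W i j * ones R n j 0 = \sum_j W i j.
    by apply: eq_bigr => j _; rewrite mxE mulr1.
  have -> : \sum_j Y^T i j * ones R n j 0 = \sum_j Y j i.
    by apply: eq_bigr => j _; rewrite !mxE mulr1.
  by ring.
have -> : \sum_i u i 0 * (1 - x i 0) = \sum_i u i 0 - \sum_i u i 0 * x i 0.
  by rewrite -sumrB; apply: eq_bigr => i _; ring.
have -> : \sum_i \sum_j (2^-1 *: W) i j * (X i j - x i 0 - x j 0 + 1) =
    2^-1 * (\sum_i \sum_j W i j * X i j - (\sum_i \sum_j W i j * x i 0) *+ 2
    + \sum_i \sum_j W i j).
  rewrite mulr2n [T in _ - (T + _)]exchange_big /= opprD addrA.
  rewrite -!sumrB -big_split mulr_sumr; apply: eq_bigr => i _.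
  rewrite -!sumrB -big_split mulr_sumr; apply: eq_bigr => j _.
  by rewrite /= mxE sWE; ring.
have -> : \sum_i \sum_j (2^-1 *: Z) i j * X i j =
    2^-1 * \sum_i \sum_j Z i j * X i j.
  rewrite mulr_sumr; apply: eq_bigr => i _.
  by rewrite mulr_sumr; apply: eq_bigr => j _; rewrite mxE mulrA.
have -> : \sum_i \sum_j Y i j * (x j 0 - X i j) =
    \sum_i \sum_j Y i j * x j 0 - \sum_i \sum_j Y i j * X i j.
  rewrite -sumrB; apply: eq_bigr => i _; rewrite -sumrB.
  by apply: eq_bigr => j _; ring.
by field.
Qed.

(** Weak duality: the constant of [alg1_obj] is the common minimum, attained at
    the vertex that is 0 on [L] and 1 elsewhere. *)
Lemma alg1_exact L u v W Y Z :
  alg1_choice L u v W Y Z -> exact_rlt (alg1_output u v W Y Z).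
Proof.
move=> [[u0 uL] [v0 vU] [sW W0 WLL] [Y0 YLU] [sZ Z0 ZUU]].
have ge0 m p (A : 'M[R]_(m, p)) : le_mx 0 A -> forall i j, 0 <= A i j.
  by move=> A0 i j; have := A0 i j; rewrite mxE.
set Q := (alg1_output u v W Y Z).1; set c := (alg1_output u v W Y Z).2.
pose x : 'cV[R]_n := \col_i (i \notin L)%:R.
pose l := - (\sum_i u i 0 + 2^-1 * \sum_i \sum_j W i j).
have xb : box x by apply/boxP => i; rewrite mxE ler0n lern1 leq_b1.
have lb y X : rlt_feasible (y, X) -> l <= rlt_obj Q c (y, X).
  move=> /rlt_feasibleP[sX /boxP yb Xb]; rewrite alg1_obj // lerDl.
  have u_ge0 := ge0 _ _ _ u0; have v_ge0 := ge0 _ _ _ v0.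
  have Y_ge0 := ge0 _ _ _ Y0.
  have half_ge0 (A : 'M[R]_n) : le_mx 0 A -> forall i j, 0 <= (2^-1 *: A) i j.
    by move=> A0 i j; rewrite mxE mulr_ge0 ?invr_ge0 ?ge0.
  have W_ge0 := half_ge0 _ W0; have Z_ge0 := half_ge0 _ Z0.
  rewrite !addr_ge0 //;
    apply: sumr_ge0 => i _; try apply: sumr_ge0 => j _;
    apply: mulr_ge0 => //; try by case: (Xb i j).
    by rewrite subr_ge0; case/andP: (yb i).
  by case/andP: (yb i).
(* Complementary slackness: each weighted slack vanishes at [x x^T]. *)
have lx : rlt_obj Q c (x, x *m x^T) = l.
  have /rlt_feasibleP[sX _ _] := rank1_feasible xb.
  have xL i : i \in L -> x i 0 = 0 by rewrite mxE => ->.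
  have xU i : i \notin L -> x i 0 = 1 by rewrite mxE => ->.
  rewrite alg1_obj // -/l /lagrangian.
  rewrite [T in _ + (T + _ + _ + _ + _)]big1; last first.
    move=> i _; have [/uL ->|/xU ->] := boolP (i \in L); ring.
  rewrite [T in _ + (_ + T + _ + _ + _)]big1; last first.
    move=> i _; have [/xL ->|iU] := boolP (i \in L); first ring.
    by rewrite vU ?inE // mul0r.
  rewrite [T in _ + (_ + _ + T + _ + _)]big1; last first.
    move=> i _; apply: big1 => j _; rewrite rank1E.
    have [iL|/xU ->] := boolP (i \in L); last ring.
    have [jL|/xU ->] := boolP (j \in L); last ring.
    by rewrite mxE WLL // mulr0 mul0r.
  rewrite [T in _ + (_ + _ + _ + T + _)]big1; last first.
    move=> i _; apply: big1 => j _; rewrite rank1E.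
    have [iL|/xU ->] := boolP (i \in L); last ring.
    have [/xL ->|jU] := boolP (j \in L); first ring.
    by rewrite YLU ?inE // mul0r.
  rewrite [T in _ + (_ + _ + _ + _ + T)]big1; last first.
    move=> i _; apply: big1 => j _; rewrite rank1E.
    have [/xL ->|iU] := boolP (i \in L); first ring.
    have [/xL ->|jU] := boolP (j \in L); first ring.
    by rewrite mxE ZUU ?inE // mulr0 mul0r.
  by ring.
split.
  by apply/matrixP => i j; rewrite /Q /= -[in RHS]sW -[in RHS]sZ !mxE; ring.
exists l; split; split.
- by exists x => //; rewrite quad_rlt_obj.
- by move=> _ [y yb <-]; rewrite quad_rlt_obj; apply/lb/rank1_feasible.
- by exists (x, x *m x^T) => //; apply: rank1_feasible.
- by move=> _ [[y X] yX <-]; apply: lb.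
Qed.

(** * Exact instances are outputs of the algorithm *)

Definition sym_part D : 'M[R]_n := \matrix_(i, j) (2^-1 * (D i j + D j i)).

(** One index per constraint, in the order of the terms of [lagrangian]. *)
Definition rlt_index : finType :=
  ('I_n + 'I_n + 'I_n * 'I_n + 'I_n * 'I_n + 'I_n * 'I_n)%type.

(** The slacks, homogenised by [t] and evaluated at the symmetric part of an
    arbitrary matrix: this removes the symmetry constraint on [X], so that the
    forms live on a product of full matrix spaces. *)
Definition rlt_form (k : rlt_index) (z : R^o * 'cV[R]_n * 'M[R]_n) : R :=
  let: (t, x, D) := z in
  let X := sym_part D in
  match k with
  | inl (inl (inl (inl i))) => t - x i 0
  | inl (inl (inl (inr i))) => x i 0
  | inl (inl (inr (i, j))) => X i j - x i 0 - x j 0 + t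
  | inl (inr (i, j)) => x j 0 - X i j
  | inr (i, j) => X i j
  end.

Definition hom_obj Q c (l : R) (z : R^o * 'cV[R]_n * 'M[R]_n) : R :=
  2^-1 * (\sum_i \sum_j Q i j * z.2 i j) + \sum_i c i 0 * z.1.2 i 0 - l * z.1.1.

Lemma rlt_form_scalar k : scalar (rlt_form k).
Proof.
move=> a [[t x] D] [[t' x'] D'].
have sE : a *: t = a * (t : R) by [].
by case: k => [[[[i|i]|[i j]]|[i j]]|[i j]]; rewrite /= ?mxE ?sE; ring.
Qed.

Lemma hom_obj_scalar Q c l : scalar (hom_obj Q c l).
Proof.
move=> a [[t x] D] [[t' x'] D']; rewrite /hom_obj /=.
have sE : a *: t = a * (t : R) by [].
rewrite sE.
have -> : \sum_i \sum_j Q i j * (a *: D + D') i j =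
    a * (\sum_i \sum_j Q i j * D i j) + \sum_i \sum_j Q i j * D' i j.
  rewrite mulr_sumr -big_split; apply: eq_bigr => i _ /=.
  rewrite mulr_sumr -big_split; apply: eq_bigr => j _ /=.
  by rewrite !mxE; ring.
have -> : \sum_i c i 0 * (a *: x + x') i 0 =
    a * (\sum_i c i 0 * x i 0) + \sum_i c i 0 * x' i 0.
  rewrite mulr_sumr -big_split; apply: eq_bigr => i _ /=.
  by rewrite !mxE; ring.
by ring.
Qed.

Lemma sum_sym_part Q D : Sym Q ->
  \sum_i \sum_j Q i j * sym_part D i j = \sum_i \sum_j Q i j * D i j.
Proof.
move=> sQ; have sQE i j : Q j i = Q i j by rewrite -[in RHS]sQ mxE.
have -> : \sum_i \sum_j Q i j * sym_part D i j =
    2^-1 * (\sum_i \sum_j Q i j * D i j + \sum_i \sum_j Q j i * D j i).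
  rewrite -big_split mulr_sumr; apply: eq_bigr => i _ /=.
  rewrite -big_split mulr_sumr; apply: eq_bigr => j _ /=.
  by rewrite [sym_part _ _ _]mxE [Q j i]sQE; ring.
by rewrite [T in _ * (_ + T)]exchange_big /=; field.
Qed.

(** The bound [l] of the affine problem passes to its cone.  A point with
    [t > 0] is rescaled to a feasible one; at [t = 0] both [x] and the
    symmetric part of the matrix vanish.  The sign of [t] follows from [0 <= x_i <= t] for some [i], hence
    the condition [0 < n]. *)
Lemma rlt_homogenization Q c l : (0 < n)%N -> Sym Q ->
    (forall x X, rlt_feasible (x, X) -> l <= rlt_obj Q c (x, X)) ->
  forall z, (forall k, 0 <= rlt_form k z) -> 0 <= hom_obj Q c l z.
Proof.
move=> n_gt0 sQ lb [[t x] D] zk.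
set S := sym_part D.
have zu i : 0 <= t - x i 0 := zk (inl (inl (inl (inl i)))).
have zv i : 0 <= x i 0 := zk (inl (inl (inl (inr i)))).
have zW i j : 0 <= S i j - x i 0 - x j 0 + t := zk (inl (inl (inr (i, j)))).
have zY i j : 0 <= x j 0 - S i j := zk (inl (inr (i, j))).
have zZ i j : 0 <= S i j := zk (inr (i, j)).
have objE : hom_obj Q c l (t, x, D) =
    2^-1 * (\sum_i \sum_j Q i j * S i j) + \sum_i c i 0 * x i 0 - l * t.
  by rewrite /hom_obj /= -(sum_sym_part D sQ).
have t_ge0 : 0 <= t.
  by have := zu (Ordinal n_gt0); have := zv (Ordinal n_gt0); lra.
(* Boundedness of the relaxation: at scale 0 both [x] and [S] vanish. *)
rewrite objE; have [t0|t_neq0] := eqVneq t 0.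
  have x0 i : x i 0 = 0.
    by have := zu i; have := zv i; rewrite t0; lra.
  rewrite [T in _ * T]big1 ?big1 ?t0; first by rewrite !mulr0 addr0 subr0.
    by move=> i _; rewrite x0 mulr0.
  move=> i _; apply: big1 => j _.
  have -> : S i j = 0 by have := zY i j; have := zZ i j; rewrite x0; lra.
  by rewrite mulr0.
have t_gt0 : 0 < t by rewrite lt_neqAle eq_sym t_neq0.
have scE m p (A : 'M[R]_(m, p)) i j : (t^-1 *: A) i j = t^-1 * A i j.
  by rewrite mxE.
have feas : rlt_feasible (t^-1 *: x, t^-1 *: S).
  have sc e : 0 <= e -> 0 <= t^-1 * e by apply: mulr_ge0; rewrite invr_ge0.
  apply/rlt_feasibleP; split.
  - by apply/matrixP => i j; rewrite !mxE [D j i + _]addrC.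
  - apply/boxP => i; rewrite mxE sc //=.
    by rewrite mulrC ler_pdivrMr // mul1r -subr_ge0.
  move=> i j; rewrite !scE; split; first exact: sc.
    have -> : t^-1 * S i j - t^-1 * x i 0 - t^-1 * x j 0 + 1 =
        t^-1 * (S i j - x i 0 - x j 0 + t) by field.
    exact: sc.
  by rewrite -mulrBr sc.
have := lb _ _ feas; rewrite rlt_objE.
have -> : \sum_i \sum_j Q i j * (t^-1 *: S) i j =
    t^-1 * \sum_i \sum_j Q i j * S i j.
  rewrite mulr_sumr; apply: eq_bigr => i _.
  by rewrite mulr_sumr; apply: eq_bigr => j _; rewrite scE; ring.
have -> : \sum_i c i 0 * (t^-1 *: x) i 0 = t^-1 * \sum_i c i 0 * x i 0.
  by rewrite mulr_sumr; apply: eq_bigr => i _; rewrite mxE; ring.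
rewrite mulrCA -mulrDr mulrC ler_pdivlMr // => lt_obj.
by rewrite subr_ge0.
Qed.

Lemma sum_delta (F : 'I_n -> 'I_n -> R) i j :
  \sum_k \sum_l F k l * (delta_mx i j : 'M[R]_n) k l = F i j.
Proof.
rewrite (bigD1 i) //= (bigD1 j) //= mxE !eqxx mulr1 big1 => [|l /negPf lj].
  rewrite addr0 big1 ?addr0 // => k /negPf ki; apply: big1 => l _.
  by rewrite mxE ki mulr0.
by rewrite mxE lj andbF mulr0.
Qed.

Lemma sum_cdelta (f : 'I_n -> R) i :
  \sum_k f k * (delta_mx i 0 : 'cV[R]_n) k 0 = f i.
Proof.
rewrite (bigD1 i) //= mxE !eqxx mulr1 big1 ?addr0 // => k /negPf ki.
by rewrite mxE ki mulr0.
Qed.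

Lemma sum_sym_delta W i j :
  \sum_k \sum_l W k l * sym_part (delta_mx i j) k l = 2^-1 * (W i j + W j i).
Proof.
rewrite -(sum_delta W) -(sum_delta (fun k l => W l k)).
rewrite [T in _ + T]exchange_big /= -big_split mulr_sumr /=.
apply: eq_bigr => k _; rewrite -big_split mulr_sumr /=.
by apply: eq_bigr => l _; rewrite [sym_part _ _ _]mxE; ring.
Qed.

Lemma lagrangian_matrix u v W Y Z i j :
  lagrangian u v W Y Z 0 0 (sym_part (delta_mx i j)) =
  2^-1 * (W i j + W j i - (Y i j + Y j i) + (Z i j + Z j i)).
Proof.
have z k : (0 : 'cV[R]_n) k 0 = 0 by rewrite mxE.
rewrite /lagrangian big1 => [|k _]; last by rewrite z subr0 mulr0.
rewrite big1 => [|k _]; last by rewrite z mulr0.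
under [T in _ + T + _ + _]eq_bigr => k _ do
  under eq_bigr => l _ do rewrite !z !subr0 addr0.
under [T in _ + T + _]eq_bigr => k _ do
  under eq_bigr => l _ do rewrite z sub0r mulrN.
under [T in _ + T + _]eq_bigr => k _ do rewrite sumrN.
by rewrite sumrN !sum_sym_delta; ring.
Qed.

Lemma lagrangian_vector u v W Y Z i :
  lagrangian u v W Y Z 0 (delta_mx i 0) 0 =
  - u i 0 + v i 0 - \sum_j (W i j + W j i) + \sum_j Y j i.
Proof.
have z k l : (0 : 'M[R]_n) k l = 0 by rewrite mxE.
set d := delta_mx i 0; rewrite /lagrangian.
have -> : \sum_k u k 0 * (0 - d k 0) = - u i 0.
  rewrite -[in RHS](sum_cdelta (fun k => u k 0)) -sumrN.
  by apply: eq_bigr => k _; ring.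
rewrite (sum_cdelta (fun k => v k 0)).
have -> : \sum_k \sum_l W k l * ((0 : 'M[R]_n) k l - d k 0 - d l 0 + 0) =
    - \sum_j (W i j + W j i).
  have := sum_cdelta (fun k => \sum_j (W k j + W j k)) i; rewrite -/d => <-.
  under [in RHS]eq_bigr => k _ do rewrite mulr_suml.
  under [in RHS]eq_bigr => k _ do under eq_bigr => l _ do rewrite mulrDl.
  under [in RHS]eq_bigr => k _ do rewrite big_split /=.
  rewrite big_split /= [T in - (_ + T)]exchange_big /= -big_split -sumrN /=.
  apply: eq_bigr => k _; rewrite -big_split -sumrN /=.
  by apply: eq_bigr => l _; rewrite z; ring.
have -> : \sum_k \sum_l Y k l * (d l 0 - (0 : 'M[R]_n) k l) = \sum_j Y j i.
  apply: eq_bigr => k _.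
  have := sum_cdelta (fun l => Y k l) i; rewrite -/d => <-.
  by apply: eq_bigr => l _; rewrite z subr0.
rewrite [T in _ + T]big1 ?addr0 // => k _.
by apply: big1 => l _; rewrite z mulr0.
Qed.

(** Comparison of coefficients on the basis directions.  Only the symmetric
    parts of the [W] and [Z] multipliers are determined by the form, which is
    why they are symmetrised. *)
Lemma lagrangian_alg1 Q c l u v W Y Z :
    (forall t x D, hom_obj Q c l (t, x, D) =
                   lagrangian u v W Y Z t x (sym_part D)) ->
  (Q, c) = alg1_output u v (W + W^T) Y (Z + Z^T).
Proof.
move=> id; congr pair.
  apply/matrixP => i j; have := id 0 0 (delta_mx i j).
  rewrite lagrangian_matrix /hom_obj /= sum_delta big1 => [|k _]; last first.
    by rewrite mxE mulr0.
  by rewrite !mxE; lra.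
apply/matrixP => i j; rewrite (ord1 j); have := id 0 (delta_mx i 0) 0.
have s0 : sym_part 0 = 0.
  by apply/matrixP => k k'; rewrite !mxE addr0 mulr0.
rewrite s0 lagrangian_vector /hom_obj /= (sum_cdelta (fun k => c k 0)).
rewrite big1 => [|k _]; last by apply: big1 => k' _; rewrite mxE mulr0.
rewrite mulr0 add0r mulr0 subr0 => ->; rewrite !mxE.
congr (_ + _ - _ + _).
  by apply: eq_bigr => k _; rewrite !mxE mulr1.
by apply: eq_bigr => k _; rewrite !mxE mulr1.
Qed.

(** Strong duality: the multipliers given by [farkas], with those for [W] and
    [Z] symmetrised, are valid choices for the algorithm. *)
Lemma exact_alg1 Q c : (0 < n)%N -> exact_rlt (Q, c) ->
  exists L u v W Y Z,
    alg1_choice L u v W Y Z /\ (Q, c) = alg1_output u v W Y Z.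
Proof.
move=> n_gt0 [/= sQ [l [[[x xb qx] _] [_ lb]]]].
have [|||y [y_ge0 yE]] := @farkas R _ _ (index_enum rlt_index) rlt_form
    (hom_obj Q c l) (index_enum_uniq _).
- exact: rlt_form_scalar.
- exact: hom_obj_scalar.
- move=> z zk; apply: rlt_homogenization => // [x' X' feas|k].
    by apply: lb; exists (x', X').
  by apply: zk; rewrite mem_index_enum.
have /rlt_feasibleP[sX _ Xb] := rank1_feasible xb.
have xb' := (boxP x).1 xb.
have XE i j : sym_part (x *m x^T) i j = x i 0 * x j 0.
  by rewrite mxE !rank1E; field.
(* The nonnegative terms sum to [q(x) - l = 0], so each of them is zero. *)
have comp k : rlt_form k (1, x, x *m x^T) != 0 -> y k = 0.
  have form_ge0 k' : 0 <= rlt_form k' (1, x, x *m x^T).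
    case: k' => [[[[i|i]|[i j]]|[i j]]|[i j]] /=; rewrite ?XE.
    - by rewrite subr_ge0; case/andP: (xb' i).
    - by case/andP: (xb' i).
    - by have [_ + _] := Xb i j; rewrite rank1E.
    - by have [_ _ +] := Xb i j; rewrite rank1E.
    - by have [+ _ _] := Xb i j; rewrite rank1E.
  have sum0 : \sum_k y k * rlt_form k (1, x, x *m x^T) = 0.
    by rewrite -yE /hom_obj /= -rlt_objE -quad_rlt_obj qx; ring.
  have /psumr_eq0P/(_ sum0)/(_ k isT) :
      forall k', true -> 0 <= y k' * rlt_form k' (1, x, x *m x^T).
    by move=> k' _; apply: mulr_ge0.
  by move/eqP; rewrite mulf_eq0 => /orP[/eqP->//|->].
pose u : 'cV[R]_n := \col_i y (inl (inl (inl (inl i)))).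
pose v : 'cV[R]_n := \col_i y (inl (inl (inl (inr i)))).
pose W : 'M[R]_n := \matrix_(i, j) y (inl (inl (inr (i, j)))).
pose Y : 'M[R]_n := \matrix_(i, j) y (inl (inr (i, j))).
pose Z : 'M[R]_n := \matrix_(i, j) y (inr (i, j)).
(* Fractional indices go into [L]; any rounding of them would do. *)
exists [set i | x i 0 != 1]%SET, u, v, (W + W^T), Y, (Z + Z^T).
have prod_neq a b : a != 0 -> b != 0 -> forall e : R, e = a * b -> e != 0.
  by move=> a0 b0 e ->; rewrite mulf_neq0.
have sub1_neq0 i : x i 0 != 1 -> 1 - x i 0 != 0.
  by rewrite subr_eq0 eq_sym.
have eq1_neq0 i : x i 0 = 1 -> x i 0 != 0 by move=> ->; rewrite oner_eq0.
have WE i j : x i 0 != 1 -> x j 0 != 1 -> W i j = 0.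
  move=> i1 j1; rewrite mxE comp //= XE.
  by apply: (prod_neq _ _ (sub1_neq0 _ i1) (sub1_neq0 _ j1)); ring.
have ZE i j : x i 0 = 1 -> x j 0 = 1 -> Z i j = 0.
  move=> i1 j1; rewrite mxE comp //= XE.
  by rewrite i1 j1 mulr1 oner_eq0.
split; last first.
  apply: (@lagrangian_alg1 _ _ l) => t d D.
  rewrite yE !big_sumType /= /lagrangian !pair_bigA /=.
  congr (_ + _ + _ + _ + _); apply: eq_bigr => k _;
    [| |case: k => i j|case: k => i j|case: k => i j]; by rewrite !mxE.
split.
- split=> [i j|i]; first by rewrite !mxE.
  by rewrite !inE => i1; rewrite mxE comp //= sub1_neq0.
- split=> [i j|i]; first by rewrite !mxE.
  by rewrite !inE negbK => /eqP i1; rewrite mxE comp //= eq1_neq0.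
- split=> [|i j|i j].
  + by rewrite /Sym /= linearD /= trmxK addrC.
  + by rewrite !mxE addr_ge0.
  + by rewrite !inE => i1 j1; rewrite mxE [W^T _ _]mxE !WE // addr0.
- split=> [i j|i j]; first by rewrite !mxE.
  rewrite !inE negbK => i1 /eqP j1; rewrite mxE comp //= XE.
  by apply: (prod_neq _ _ (sub1_neq0 _ i1) (eq1_neq0 _ j1)); ring.
- split=> [|i j|i j].
  + by rewrite /Sym /= linearD /= trmxK addrC.
  + by rewrite !mxE addr_ge0.
  + rewrite !inE !negbK => /eqP i1 /eqP j1.
    by rewrite mxE [Z^T _ _]mxE !ZE // addr0.
Qed.

End Exactness.

Theorem proposition4p4 (R : realType) (n : nat) (hn : (1 <= n)%N) :
  (forall (L : {set 'I_n}) (u v : 'cV[R]_n) (W Y Z : 'M[R]_n),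
     alg1_choice L u v W Y Z -> exact_rlt (alg1_output u v W Y Z)) /\
  (forall (Q : 'M[R]_n) (c : 'cV[R]_n),
     exact_rlt (Q, c) ->
     exists (L : {set 'I_n}) (u v : 'cV[R]_n) (W Y Z : 'M[R]_n),
       alg1_choice L u v W Y Z /\ (Q, c) = alg1_output u v W Y Z).
Proof.
split=> [L u v W Y Z|Q c]; first exact: alg1_exact.
exact: exact_alg1.
Qed.
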